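(* Let $F$ be a field of characteristic zero, $G$ a finite group, and let $A$ be a unitary $(G,* )$-algebra over $F$ with quadratic codimension growth and of type $F+J(A)$. Let $g,h\in G\setminus\{1\}$ and $u\in G$ with $g\neq h$ and $h\neq u$, and in each item suppose that the two group elements involved commute. Then: (1) $m_{((1)_{g^+},(1)_{h^+})}=1$ if and only if $\mathcal{G}_{2,\psi}^{g,h}\in\mathrm{var}^\sharp(A)$ or $W_{\nu_1}^{g,h}\in\mathrm{var}^\sharp(A)$. (2) $m_{((1)_{u^-},(1)_{h^-})}=1$ if and only if $\mathcal{G}_{2,\tau}^{u,h}\in\mathrm{var}^\sharp(A)$ or $W_{\nu_2}^{u,h}\in\mathrm{var}^\sharp(A)$. (3) $m_{((1)_{u^-},(1)_{g^+})}=1$ if and only if $\mathcal{G}_{2,\gamma}^{u,g}\in\mathrm{var}^\sharp(A)$ or $W_{\nu_3}^{u,g}\in\mathrm{var}^\sharp(A)$.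
   Context: A $(G,* )$-algebra is an associative $G$-graded $F$-algebra $A=\bigoplus_{g\in G}A_g$ with an ($F$-linear) involution $*$ such that $A_g^*=A_g$; put $A_g^{\pm}=\{a\in A_g:a^*=\pm a\}$. Unitary means having a unit element; type $F+J(A)$ means $A=F\cdot 1+J(A)$ with $J(A)$ the Jacobson radical. The free $(G,* )$-algebra is the free associative algebra on variables $x_{i,g}^+$ (symmetric of degree $g$) and $x_{i,g}^-$ (skew of degree $g$), $i\ge1$, $g\in G$. $\mathrm{Id}^\sharp(A)$ is the set of its elements vanishing under all evaluations $x_{i,g}^\epsilon\mapsto a\in A_g^\epsilon$; $\mathrm{var}^\sharp(A)$ is the class of all $(G,* )$-algebras $B$ with $\mathrm{Id}^\sharp(A)\subseteq\mathrm{Id}^\sharp(B)$. $P_n^\sharp$ is the span of all $w_{\sigma(1)}\cdots w_{\sigma(n)}$, $\sigma\in S_n$, $w_i\in\{x_{i,g}^\pm:g\in G\}$; $c_n^\sharp(A)=\dim_FP_n^\sharp/(P_n^\sharp\cap\mathrm{Id}^\sharp(A))$; quadratic codimension growth means $c_n^\sharp(A)=qn^2+\mathcal{O}(n)$, $q>0$. A proper polynomial is a linear combination of products of variables and commutators of variables in which variables $x_{i,1}^+$ occur only inside commutators. For distinct symbols $s^\delta,t^\epsilon$, both different from $1^+$, $\Gamma_{(1_{s^\delta},1_{t^\epsilon})}$ is the space of multilinear proper polynomials in $x_{1,s}^\delta,x_{2,t}^\epsilon$ (with basis $x_{1,s}^\delta x_{2,t}^\epsilon$, $[x_{1,s}^\delta,x_{2,t}^\epsilon]$),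 and $m_{((1)_{s^\delta},(1)_{t^\epsilon})}$ is the multiplicity of the (unique) irreducible character $\chi_{(1)}\otimes\chi_{(1)}$ of $S_1\times S_1$ in $\Gamma_{(1_{s^\delta},1_{t^\epsilon})}/(\Gamma_{(1_{s^\delta},1_{t^\epsilon})}\cap\mathrm{Id}^\sharp(A))$, i.e. the dimension of this quotient. $\mathcal{G}_2$ is the unital algebra with basis $1,e_1,e_2,e_1e_2$ and $e_ie_j=-e_je_i$ (so $e_i^2=0$), with involutions determined by $\psi(e_i)=e_i$; $\tau(e_i)=-e_i$; $\gamma(e_i)=(-1)^ie_i$. For commuting $a,b\in G$ and $*\in\{\psi,\tau,\gamma\}$, $\mathcal{G}_{2,*}^{a,b}$ is $\mathcal{G}_2$ with involution $*$ and $1,e_1,e_2,e_1e_2$ of degrees $1,a,b,ab$. $W=\mathrm{span}_F\{I_4,\ e_{12}+e_{34},\ e_{13}+e_{24},\ e_{14}\}\subset UT_4(F)$, where $UT_4(F)$ is the algebra of upper triangular $4\times4$ matrices, $e_{ij}$ are the elementary matrices and $I_4$ is the identity matrix; $\nu_1$ is the trivial involution; $\nu_2$ fixes $I_4,e_{14}$ and negates $e_{12}+e_{34}$, $e_{13}+e_{24}$; $\nu_3$ fixes $I_4$, $e_{13}+e_{24}$ and negates $e_{12}+e_{34}$, $e_{14}$. $W_{\nu_i}^{a,b}$ is $W$ with involution $\nu_i$ and $I_4,\ e_{12}+e_{34},\ e_{13}+e_{24},\ e_{14}$ of degrees $1,a,b,ab$.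
   Formalization: In each item ''or'' is made exclusive (exactly one of the two algebras lies in the variety): with inclusive ''or'' the claim fails, e.g. for F(1,1)+J(G_2)×J(W) inside G_2×W, both algebras lie in the variety but the multiplicity is 2. *)

(* Defs.v *)
From HB Require Import structures.
From mathcomp Require Import all_boot all_order all_algebra all_fingroup all_field.
From mathcomp Require Import boolp classical_sets reals.
From mathcomp Require Import monalg.
From mathcomp Require Import ring.

Set Implicit Arguments.
Unset Strict Implicit.
Unset Printing Implicit Defensive.

Import Order.TTheory GRing.Theory Num.Theory.
Local Open Scope classical_set_scope.
Local Open Scope ring_scope.

Record gstar (gT : finGroupType) (F : fieldType) (A : algType F) := GStar {
  hcomp : gT -> set A;
  star : {linear A -> A};
  hcomp0 : forall g, hcomp g 0;
  hcompP : forall g (c : F) x y, hcomp g x -> hcomp g y -> hcomp g (c *: x + y);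
  hcomp_sum : forall x, exists2 f : gT -> A,
    forall g, hcomp g (f g) & x = \sum_g f g;
  hcomp_direct : forall f : gT -> A, (forall g, hcomp g (f g)) ->
    \sum_g f g = 0 -> forall g, f g = 0;
  hcompM : forall g h x y, hcomp g x -> hcomp h y -> hcomp (g * h)%g (x * y);
  starM : forall x y, star (x * y) = star y * star x;
  starK : involutive star;
  star_hcomp : forall g x, hcomp g x -> hcomp g (star x)
}.

(* A symbol g^+ is (g, true) and g^- is (g, false). *)
Definition symb (gT : finGroupType) := (gT * bool)%type.

Definition sym_comp (gT : finGroupType) (F : fieldType) (A : algType F)
    (S : gstar gT A) (s : symb gT) : set A :=
  [set x | hcomp S s.1 x /\ star S x = if s.2 then x else - x].

(* The first component is the index i, counted from 0: x_{1,g}^+ is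
   (0, (g, true)). *)
Definition gvar (gT : finGroupType) := (nat * symb gT)%type.

Definition freealg (gT : finGroupType) (F : fieldType) :=
  {malg F[{fmonom (gvar gT)}]}.

Definition fvar (gT : finGroupType) (F : fieldType) (i : nat) (s : symb gT) :
  freealg gT F := (<< fmu (i, s) >>).

Definition feval (gT : finGroupType) (F : fieldType) (A : algType F)
    (v : gvar gT -> A) (p : freealg gT F) : A :=
  mmap (in_alg A) (fun m : {fmonom (gvar gT)} => \prod_(x <- m) v x) p.

Definition Id (gT : finGroupType) (F : fieldType) (A : algType F)
    (S : gstar gT A) : set (freealg gT F) :=
  [set p | forall v : gvar gT -> A,
     (forall i s, sym_comp S s (v (i, s))) -> feval v p = 0].

(* Membership in the variety of A, which is only needed for unitary algebras. *)
Definition in_var (gT : finGroupType) (F : fieldType) (A : algType F)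
    (S : gstar gT A) (B : algType F) (T : gstar gT B) : Prop :=
  Id S `<=` Id T.

Definition lin_span (F : fieldType) (V : lmodType F) (X : set V) : set V :=
  [set p | exists n (c : 'I_n -> F) (x : 'I_n -> V),
     (forall i, X (x i)) /\ p = \sum_(i < n) c i *: x i].

Definition quot_basis (F : fieldType) (V : lmodType F) (U W : set V)
    (d : nat) (b : 'I_d -> V) : Prop :=
  [/\ forall i, U (b i),
      forall c : 'I_d -> F, W (\sum_i c i *: b i) -> forall i, c i = 0
    & forall u, U u -> exists c : 'I_d -> F, W (u - \sum_i c i *: b i)].

(* dim (U / (U :&: W)), for subspaces U and W; the value is 0 if this
   dimension is infinite, which does not occur below. *)
Definition quot_dim (F : fieldType) (V : lmodType F) (U W : set V) : nat :=
  xget 0%N [set d | exists b : 'I_d -> V, quot_basis U (U `&` W) b].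

Definition Pn (gT : finGroupType) (F : fieldType) (n : nat) :
    set (freealg gT F) :=
  lin_span [set p | exists (sigma : 'S_n) (w : 'I_n -> symb gT),
    p = \prod_(i < n) fvar F (sigma i) (w (sigma i))].

Definition codim (gT : finGroupType) (F : fieldType) (A : algType F)
    (S : gstar gT A) (n : nat) : nat :=
  quot_dim (@Pn gT F n) (Id S).

Definition quadratic_growth (R : realType) (gT : finGroupType) (F : fieldType)
    (A : algType F) (S : gstar gT A) : Prop :=
  exists2 q : R, 0 < q & exists (C : R) (N : nat), forall n, (N <= n)%N ->
    `|(codim S n)%:R - q * n%:R ^+ 2| <= C * n%:R.

Definition left_ideal (F : fieldType) (A : algType F) (I : set A) : Prop :=
  [/\ I 0, forall x y, I x -> I y -> I (x + y)
    & forall a x, I x -> I (a * x)].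

Definition maximal_left_ideal (F : fieldType) (A : algType F) (I : set A) :=
  [/\ left_ideal I, I <> setT
    & forall J, left_ideal J -> I `<=` J -> J <> setT -> J = I].

Definition jacobson (F : fieldType) (A : algType F) : set A :=
  [set x | forall I : set A, maximal_left_ideal I -> I x].

Definition type_FJ (F : fieldType) (A : algType F) : Prop :=
  forall a : A, exists c j, jacobson j /\ a = c%:A + j.

Definition commutator (V : pzRingType) (x y : V) : V := x * y - y * x.

Inductive long_commutator (gT : finGroupType) (F : fieldType) :
    freealg gT F -> Prop :=
| LongComm2 i s j t :
    long_commutator (commutator (fvar F i s) (fvar F j t))
| LongCommS c i s :
    long_commutator c -> long_commutator (commutator c (fvar F i s)).

Definition proper_factor (gT : finGroupType) (F : fieldType) :
    set (freealg gT F) :=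
  [set p | long_commutator p \/
     exists i s, s != (1%g, true) /\ p = fvar F i s].

Definition proper (gT : finGroupType) (F : fieldType) : set (freealg gT F) :=
  lin_span [set p | exists n (f : 'I_n -> freealg gT F),
    (forall i, proper_factor (f i)) /\ p = \prod_(i < n) f i].

Definition multilinear_in (gT : finGroupType) (F : fieldType)
    (xs : seq (gvar gT)) : set (freealg gT F) :=
  [set p | forall m : {fmonom (gvar gT)}, p@_m != 0 -> perm_eq m xs].

Definition Gamma11 (gT : finGroupType) (F : fieldType) (s t : symb gT) :
    set (freealg gT F) :=
  @proper gT F `&` @multilinear_in gT F [:: (0%N, s); (1%N, t)].

(* S_1 x S_1 is trivial, so the multiplicity of its only irreducible character
   is the dimension of the module. *)
Definition mult11 (gT : finGroupType) (F : fieldType) (A : algType F)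
    (S : gstar gT A) (s t : symb gT) : nat :=
  quot_dim (@Gamma11 gT F s t) (Id S).

Section DiagonalStructure.
Variables (gT : finGroupType) (F : fieldType) (A : falgType F) (n : nat).
Variables (X : n.-tuple A) (d : 'I_n -> gT) (e : 'I_n -> F).

Definition basis_hcomp (g : gT) : set A :=
  [set x | exists c : 'I_n -> F, x = \sum_(i | d i == g) c i *: X`_i].

Definition basis_star (x : A) : A := \sum_i coord X i x *: (e i *: X`_i).

Lemma basis_star_linear : linear basis_star.
Proof.
move=> c x y; rewrite /basis_star scaler_sumr -big_split /=.
by apply: eq_bigr => i _; rewrite linearP scalerDl !scalerA.
Qed.

HB.instance Definition _ :=
  GRing.isSemilinear.Build F A A _ basis_star
    (GRing.semilinear_linear basis_star_linear).

Hypothesis Xbasis : basis_of fullv X.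
Hypothesis Xmul : forall i j : 'I_n, basis_hcomp (d i * d j)%g (X`_i * X`_j).
Hypothesis eK : forall i, e i * e i = 1.
Hypothesis Xstar : forall i j : 'I_n,
  basis_star (X`_i * X`_j) = (e i * e j) *: (X`_j * X`_i).

Let Xfree : free X := basis_free Xbasis.

Let coordX x : x = \sum_i coord X i x *: X`_i.
Proof. by apply: coord_basis (memvf x). Qed.

Let hcomp0 g : basis_hcomp g 0.
Proof. by exists (fun=> 0); rewrite big1 // => i _; rewrite scale0r. Qed.

Let hcompP g (c : F) x y :
  basis_hcomp g x -> basis_hcomp g y -> basis_hcomp g (c *: x + y).
Proof.
move=> [a ->] [b ->]; exists (fun i => c * a i + b i).
rewrite scaler_sumr -big_split /=.
by apply: eq_bigr => i _; rewrite scalerDl scalerA.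
Qed.

Let hcomp_bigop g (I : Type) (r : seq I) (P : pred I) (f : I -> A) :
  (forall i, P i -> basis_hcomp g (f i)) -> basis_hcomp g (\sum_(i <- r | P i) f i).
Proof.
move=> H; elim/big_rec: _ => // i x Pi gx.
by rewrite -[f i]scale1r; apply: hcompP => //; apply: H.
Qed.

Let hcomp_scale g (c : F) x : basis_hcomp g x -> basis_hcomp g (c *: x).
Proof. by move=> gx; rewrite -[c *: x]addr0; apply: hcompP. Qed.

Let hcomp_sum x : exists2 f : gT -> A,
  forall g, basis_hcomp g (f g) & x = \sum_g f g.
Proof.
exists (fun g => \sum_(i | d i == g) coord X i x *: X`_i).
  by move=> g; exists (fun i => coord X i x).
by rewrite [LHS]coordX (partition_big d xpredT).
Qed.

Let hcomp_direct (f : gT -> A) : (forall g, basis_hcomp g (f g)) ->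
  \sum_g f g = 0 -> forall g, f g = 0.
Proof.
move=> /choice[c fE] f0 g; rewrite fE.
have: \sum_i c (d i) i *: X`_i = 0.
  rewrite -[RHS]f0 (partition_big d xpredT) //=; apply: eq_bigr => h _.
  by rewrite fE; apply: eq_bigr => i /eqP->.
move/freeP: Xfree => /[apply] c0.
by rewrite big1 // => i /eqP<-; rewrite c0 scale0r.
Qed.

Let hcompM g h x y :
  basis_hcomp g x -> basis_hcomp h y -> basis_hcomp (g * h)%g (x * y).
Proof.
move=> [a ->] [b ->]; rewrite mulr_suml; apply: hcomp_bigop => i /eqP<-.
rewrite mulr_sumr; apply: hcomp_bigop => j /eqP<-.
by rewrite -scalerAl -scalerAr; do 2!apply: hcomp_scale.
Qed.

Let starX (i : 'I_n) : basis_star X`_i = e i *: X`_i.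
Proof.
rewrite /basis_star (bigD1 i) //= coord_free // eqxx scale1r big1 ?addr0 //.
by move=> j /negPf ji; rewrite coord_free // eq_sym ji scale0r.
Qed.

Let starM x y : basis_star (x * y) = basis_star y * basis_star x.
Proof.
have starE z : basis_star z = \sum_i coord X i z *: (e i *: X`_i) by [].
rewrite {1}[x]coordX mulr_suml linear_sum [basis_star x]starE mulr_sumr /=.
apply: eq_bigr => i _.
rewrite {1}[y]coordX mulr_sumr linear_sum [basis_star y]starE mulr_suml /=.
apply: eq_bigr => j _.
rewrite -!(scalerAl, scalerAr) !linearZ /= Xstar !scalerA.
by congr (_ *: _); ring.
Qed.

Let starK : involutive basis_star.
Proof.
move=> x; rewrite {2}/basis_star linear_sum [RHS]coordX /=.
by apply: eq_bigr => i _; rewrite !linearZ /= starX !scalerA -mulrA eK mulr1.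
Qed.

Let star_hcomp g x : basis_hcomp g x -> basis_hcomp g (basis_star x).
Proof.
move=> [c ->]; rewrite linear_sum /=; apply: hcomp_bigop => i /eqP<-.
rewrite linearZ /= starX; do 2!apply: hcomp_scale.
by exists (fun j => (i == j)%:R); rewrite (bigD1 i) //= eqxx scale1r big1 ?addr0
  // => j /andP[_ /negPf]; rewrite eq_sym => ->; rewrite scale0r.
Qed.

Definition diag_gstar : gstar gT A :=
  @GStar gT F A basis_hcomp basis_star hcomp0 hcompP hcomp_sum hcomp_direct
    hcompM starM starK star_hcomp.

End DiagonalStructure.

(* The common shape of the two algebras below: a basis 1, p, q, r = p q with
   p^2 = q^2 = 0 and q p = w p q, w = 1 or -1, of degrees 1, a, b, ab, and an
   involution with star p = s1 p and star q = s2 q, where s1, s2 = 1 or -1;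
   hence star r = (star q) (star p) = s1 s2 w r. *)
Section FourDim.
Variables (gT : finGroupType) (F : fieldType) (A : falgType F).
Variables (p q r : A) (w : F) (a b : gT) (s1 s2 : bool).

Definition four_basis : 4.-tuple A := [tuple 1; p; q; r].
Definition four_deg (i : 'I_4) : gT := nth 1%g [:: 1; a; b; a * b]%g i.
Definition four_sign (i : 'I_4) : F :=
  [:: 1; (-1) ^+ s1; (-1) ^+ s2; (-1) ^+ s1 * (-1) ^+ s2 * w]`_i.

Hypothesis Xbasis : basis_of fullv four_basis.
Hypothesis pp : p * p = 0.
Hypothesis qq : q * q = 0.
Hypothesis pq : p * q = r.
Hypothesis qp : q * p = w *: r.
Hypothesis ww : w * w = 1.
Hypothesis cab : commute a b.

Let X := four_basis.
Let hc := basis_hcomp X four_deg.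

Let zeros : [/\ p * r = 0, r * p = 0, q * r = 0, r * q = 0 & r * r = 0].
Proof.
have pr : p * r = 0 by rewrite -pq mulrA pp mul0r.
have rq : r * q = 0 by rewrite -pq -mulrA qq mulr0.
have rE : r = w *: (q * p) by rewrite qp scalerA ww scale1r.
split=> //.
- by rewrite rE -scalerAl -mulrA pp mulr0 scaler0.
- by rewrite rE -scalerAr mulrA qq mul0r scaler0.
- by rewrite -{2}pq mulrA -{1}[r]scale1r -ww -scalerA -qp -scalerAl -mulrA pp
  mulr0 scaler0 mul0r.
Qed.

Let hcX g (c : F) (k : 'I_4) : four_deg k = g -> hc g (c *: X`_k).
Proof.
move=> dk; exists (fun j => if j == k then c else 0).
rewrite (bigD1 k) ?dk //= eqxx big1 ?addr0 // => j /andP[_ /negPf->].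
by rewrite scale0r.
Qed.

Let hc0 g : hc g 0.
Proof. by exists (fun=> 0); rewrite big1 // => i _; rewrite scale0r. Qed.

Let hcX1 g (k : 'I_4) : four_deg k = g -> hc g X`_k.
Proof. by move=> /(@hcX g 1 k); rewrite scale1r. Qed.

Lemma four_mul (i j : 'I_4) : hc (four_deg i * four_deg j)%g (X`_i * X`_j).
Proof.
have [pr rp qr rq rr] := zeros.
have c0 := @hcX1 _ (@Ordinal 4 0 isT) erefl.
have c1 := @hcX1 _ (@Ordinal 4 1 isT) erefl.
have c2 := @hcX1 _ (@Ordinal 4 2 isT) erefl.
have c3 := @hcX1 _ (@Ordinal 4 3 isT) erefl.
have cw := @hcX _ w (@Ordinal 4 3 isT) erefl.
case: i j => [[|[|[|[|//]]]] ?] [[|[|[|[|//]]]] ?];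
  rewrite /four_deg /= ?(mul1r, mulr1, mul1g, mulg1, pp, qq, pq, qp, pr, rp, qr, rq, rr) //.
by rewrite -cab.
Qed.

Let starX (i : 'I_4) : basis_star X four_sign X`_i = four_sign i *: X`_i.
Proof.
have Xfree := basis_free Xbasis.
rewrite /basis_star (bigD1 i) //= coord_free // eqxx scale1r big1 ?addr0 //.
by move=> j /negPf ji; rewrite coord_free // eq_sym ji scale0r.
Qed.

Let sgK (s : bool) : (-1) ^+ s * (-1) ^+ s = 1 :> F.
Proof. by rewrite -expr2 sqrr_sign. Qed.

Lemma four_signK (i : 'I_4) : four_sign i * four_sign i = 1.
Proof.
case: i => [[|[|[|[|//]]]] ?]; rewrite /four_sign /= ?mulr1 ?sgK //.
by rewrite mulrACA ww mulr1 mulrACA !sgK mulr1.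
Qed.

Lemma four_star (i j : 'I_4) : basis_star X four_sign (X`_i * X`_j) =
  (four_sign i * four_sign j) *: (X`_j * X`_i).
Proof.
have [pr rp qr rq rr] := zeros.
have c0 := @starX (@Ordinal 4 0 isT).
have c1 := @starX (@Ordinal 4 1 isT).
have c2 := @starX (@Ordinal 4 2 isT).
have c3 := @starX (@Ordinal 4 3 isT).
case: i j => [[|[|[|[|//]]]] ?] [[|[|[|[|//]]]] ?];
  rewrite /four_sign /= ?(mul1r, mulr1, pp, qq, pq, qp, pr, rp, qr, rq, rr) ?linearZ ?linear0
    /= ?c0 ?c1 ?c2 ?c3 /four_sign /= ?scaler0 ?scalerA //.
- by rewrite mulrC.
- by rewrite mulrCA ww mulr1 mulrC.
Qed.

Definition four_gstar : gstar gT A :=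
  diag_gstar Xbasis four_mul four_signK four_star.

Lemma four_star_p : star four_gstar p = (-1) ^+ s1 *: p.
Proof. exact: (@starX (@Ordinal 4 1 isT)). Qed.
Lemma four_star_q : star four_gstar q = (-1) ^+ s2 *: q.
Proof. exact: (@starX (@Ordinal 4 2 isT)). Qed.
Lemma four_star_r : star four_gstar r = ((-1) ^+ s1 * (-1) ^+ s2 * w) *: r.
Proof. exact: (@starX (@Ordinal 4 3 isT)). Qed.
End FourDim.

(* The algebra with basis 1, e1, e2, e1 e2 (the four unit row vectors), where
   e1 and e2 anticommute and have square zero. *)
Definition G2 (F : fieldType) := 'rV[F]_4.

Section G2Algebra.
Variable F : fieldType.
Implicit Types x y z : G2 F.

HB.instance Definition _ := Vector.on (G2 F).

Definition G2_coef x k : F := x 0 (inord k).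

Definition G2_row (s : seq F) : G2 F := \row_(k < 4) s`_k.

Definition G2_mul x y : G2 F :=
  let a := G2_coef x in let b := G2_coef y in
  G2_row [:: a 0%N * b 0%N;
             a 0%N * b 1%N + a 1%N * b 0%N;
             a 0%N * b 2%N + a 2%N * b 0%N;
             a 0%N * b 3%N + a 3%N * b 0%N + a 1%N * b 2%N - a 2%N * b 1%N].

Lemma G2_coef_row s k : (k < 4)%N -> G2_coef (G2_row s) k = s`_k.
Proof. by move=> k4; rewrite /G2_coef mxE inordK. Qed.

Lemma G2_coef0 k : G2_coef 0 k = 0.
Proof. exact: mxE. Qed.

Lemma G2_coefD x y k : G2_coef (x + y) k = G2_coef x k + G2_coef y k.
Proof. exact: mxE. Qed.

Lemma G2_coefZ c x k : G2_coef (c *: x) k = c * G2_coef x k.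
Proof. exact: mxE. Qed.

Lemma G2P x y : (forall k, (k < 4)%N -> G2_coef x k = G2_coef y k) -> x = y.
Proof.
by move=> xy; apply/rowP => i; have := xy i (ltn_ord i); rewrite /G2_coef inord_val.
Qed.

Let G2E := (G2_coef_row, G2_coefD, G2_coefZ).

Local Ltac G2_ring :=
  apply: G2P => -[|[|[|[|//]]]] _; rewrite /G2_mul !G2E //=; ring.

Lemma G2_mulA : associative G2_mul. Proof. by move=> x y z; G2_ring. Qed.
Lemma G2_mul1 : left_id (G2_row [:: 1]) G2_mul. Proof. by move=> x; G2_ring. Qed.
Lemma G2_mulr1 : right_id (G2_row [:: 1]) G2_mul. Proof. by move=> x; G2_ring. Qed.
Lemma G2_mulDl : left_distributive G2_mul +%R.
Proof. by move=> x y z; G2_ring. Qed.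
Lemma G2_mulDr : right_distributive G2_mul +%R.
Proof. by move=> x y z; G2_ring. Qed.
Lemma G2_1_neq0 : G2_row [:: 1] != 0.
Proof. by apply/eqP => /rowP/(_ ord0)/eqP; rewrite !mxE oner_eq0. Qed.

HB.instance Definition _ := GRing.Zmodule_isNzRing.Build (G2 F)
  G2_mulA G2_mul1 G2_mulr1 G2_mulDl G2_mulDr G2_1_neq0.

Lemma G2_scaleAl (c : F) x y : c *: (x * y) = c *: x * y.
Proof. by rewrite /GRing.mul /=; G2_ring. Qed.
HB.instance Definition _ := GRing.Lmodule_isLalgebra.Build F (G2 F) G2_scaleAl.

Lemma G2_scaleAr (c : F) x y : c *: (x * y) = x * (c *: y).
Proof. by rewrite /GRing.mul /=; G2_ring. Qed.
HB.instance Definition _ := GRing.Lalgebra_isAlgebra.Build F (G2 F) G2_scaleAr.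

HB.instance Definition _ := Algebra_isFalgebra.Build F (G2 F).
End G2Algebra.

Section G2Structure.
Variable F : fieldType.

Definition e1 : G2 F := G2_row [:: 0; 1].
Definition e2 : G2 F := G2_row [:: 0; 0; 1].

Let G2mulE (x y : G2 F) : x * y = G2_mul x y. Proof. by []. Qed.

Local Ltac G2_ring :=
  apply: G2P => -[|[|[|[|//]]]] _;
  rewrite ?G2mulE /G2_mul ?(G2_coef_row, G2_coefZ, G2_coefD, G2_coef0) //=; ring.

Lemma e1_sqr : e1 * e1 = 0. Proof. by G2_ring. Qed.
Lemma e2_sqr : e2 * e2 = 0. Proof. by G2_ring. Qed.
Lemma e21 : e2 * e1 = (-1) *: (e1 * e2). Proof. by G2_ring. Qed.
Lemma e12E : e1 * e2 = G2_row [:: 0; 0; 0; 1]. Proof. by G2_ring. Qed.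

Lemma G2_basis : basis_of fullv (four_basis e1 e2 (e1 * e2)).
Proof.
rewrite basisEfree subvf dimvf /= andbT; apply/freeP => k k0 i.
have := congr1 (fun x : G2 F => G2_coef x i) k0.
rewrite !big_ord_recl big_ord0 e12E /= !(G2_coefD, G2_coefZ, G2_coef_row, G2_coef0) //=.
case: i {k0} => [[|[|[|[|//]]]] ilt] /=;
  rewrite !(mulr0, mulr1, add0r, addr0) => kE; rewrite -[RHS]kE;
  by congr k; apply: val_inj.
Qed.

Let signN1 : (-1) * (-1) = 1 :> F. Proof. by rewrite mulrNN mulr1. Qed.

Variable gT : finGroupType.

Definition G2_psi (a b : gT) (cab : commute a b) : gstar gT (G2 F) :=
  four_gstar false false G2_basis e1_sqr e2_sqr erefl e21 signN1 cab.

Definition G2_tau (a b : gT) (cab : commute a b) : gstar gT (G2 F) :=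
  four_gstar true true G2_basis e1_sqr e2_sqr erefl e21 signN1 cab.

Definition G2_gamma (a b : gT) (cab : commute a b) : gstar gT (G2 F) :=
  four_gstar true false G2_basis e1_sqr e2_sqr erefl e21 signN1 cab.
End G2Structure.

(* The elementary matrices e_{ij}, with indices from 1 to 4. *)
Definition E4 (F : fieldType) (i j : nat) : 'M[F]_4 :=
  delta_mx (inord i.-1) (inord j.-1).

Definition W_gens (F : fieldType) : seq 'M[F]_4 :=
  [:: 1%:M; E4 F 1 2 + E4 F 3 4; E4 F 1 3 + E4 F 2 4; E4 F 1 4].

Definition W_vspace (F : fieldType) : {vspace 'M[F]_4} := <<W_gens F>>%VS.

Section WAlgebra.
Variable F : fieldType.
Local Notation E := (E4 F).
Let gp := E 1 2 + E 3 4.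
Let gq := E 1 3 + E 2 4.
Let gr := E 1 4.

Lemma E4_mul i j k l : (0 < j <= 4)%N -> (0 < k <= 4)%N ->
  E i j * E k l = if j == k then E i l else 0.
Proof.
move=> /andP[j0 j4] /andP[k0 k4]; rewrite /E4 [_ * _]mul_delta_mx_cond.
rewrite -val_eqE /= !inordK ?prednK // -eqSS !prednK //.
by case: eqP.
Qed.

Let mulE := (mulrDl, mulrDr, E4_mul, addr0, add0r).
Lemma W_pp : gp * gp = 0. Proof. by rewrite /gp !mulE. Qed.
Lemma W_qq : gq * gq = 0. Proof. by rewrite /gq !mulE. Qed.
Lemma W_pq : gp * gq = gr. Proof. by rewrite /gp /gq !mulE. Qed.
Lemma W_qp : gq * gp = gr. Proof. by rewrite /gp /gq !mulE. Qed.
Lemma W_pr : gp * gr = 0. Proof. by rewrite /gp /gr !mulE. Qed.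
Lemma W_qr : gq * gr = 0. Proof. by rewrite /gq /gr !mulE. Qed.
Lemma W_rp : gr * gp = 0. Proof. by rewrite /gp /gr !mulE. Qed.
Lemma W_rq : gr * gq = 0. Proof. by rewrite /gq /gr !mulE. Qed.
Lemma W_rr : gr * gr = 0. Proof. by rewrite /gr !mulE. Qed.

Lemma W_is_aspace : is_aspace (W_vspace F).
Proof.
apply/andP; split.
  by apply: has_algid1; apply: memv_span; rewrite inE eqxx.
apply/prodvP => x y; rewrite /W_vspace => /coord_span-> /coord_span->.
rewrite mulr_suml; apply: memv_suml => i _.
rewrite mulr_sumr; apply: memv_suml => j _.
rewrite -scalerAl -scalerAr; do 2!apply: memvZ.
have W k : k \in W_gens F -> k \in <<W_gens F>>%VS by apply: memv_span.
have [W0 W1 W2 W3] : [/\ 1 \in <<W_gens F>>%VS, gp \in <<W_gens F>>%VS,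
    gq \in <<W_gens F>>%VS & gr \in <<W_gens F>>%VS].
  by split; apply: W; rewrite !inE eqxx ?orbT.
case: i j => [[|[|[|[|//]]]] ?] [[|[|[|[|//]]]] ?];
  by rewrite /= -?[1%:M]/1 -/gp -/gq -/gr
     ?(mul1r, mulr1, W_pp, W_qq, W_pq, W_qp, W_pr, W_rp, W_qr, W_rq, W_rr) ?mem0v.
Qed.

Definition W_aspace : {aspace 'M[F]_4} := ASpace W_is_aspace.

Definition W := subvs_of W_aspace.
End WAlgebra.

Section WStructure.
Variable F : fieldType.
Local Notation E := (E4 F).

Definition w_elt (M : 'M[F]_4) : W F := vsproj (W_aspace F) M.
Definition wp := w_elt (E 1 2 + E 3 4).
Definition wq := w_elt (E 1 3 + E 2 4).
Definition wr := w_elt (E 1 4).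

Let w_eltK k : k \in W_gens F -> vsval (w_elt k) = k.
Proof. by move=> kW; apply: vsprojK; apply: memv_span. Qed.

Lemma wpE : vsval wp = E 1 2 + E 3 4.
Proof. by apply: w_eltK; rewrite !inE eqxx ?orbT. Qed.
Lemma wqE : vsval wq = E 1 3 + E 2 4.
Proof. by apply: w_eltK; rewrite !inE eqxx ?orbT. Qed.
Lemma wrE : vsval wr = E 1 4.
Proof. by apply: w_eltK; rewrite !inE eqxx ?orbT. Qed.

Lemma vsval_W1 : vsval (1 : W F) = 1%:M.
Proof.
have -> : vsval (1 : W F) = algid (W_aspace F) by [].
have W1 : 1 \in W_aspace F by apply: memv_span; apply: mem_head.
by apply/eqP; rewrite algid_eq1.
Qed.

Let vsval_WM (x y : W F) : vsval (x * y) = vsval x * vsval y.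
Proof. by []. Qed.

Lemma wp_sqr : wp * wp = 0. Proof. by apply: val_inj; rewrite [LHS]vsval_WM wpE W_pp. Qed.
Lemma wq_sqr : wq * wq = 0. Proof. by apply: val_inj; rewrite [LHS]vsval_WM wqE W_qq. Qed.
Lemma wpq : wp * wq = wr.
Proof. by apply: val_inj; rewrite [LHS]vsval_WM wpE wqE [RHS]wrE W_pq. Qed.
Lemma wqp : wq * wp = 1 *: wr.
Proof. by rewrite scale1r; apply: val_inj; rewrite [LHS]vsval_WM wpE wqE [RHS]wrE W_qp. Qed.

Lemma W_basis : basis_of fullv (four_basis wp wq wr).
Proof.
rewrite basisEfree subvf dimvf /=; apply/andP; split; last first.
  by rewrite /dim /= (leq_trans (dim_span _)).
apply/freeP => k k0 i.
have k0' : \sum_(j < 4) k j *: (W_gens F)`_j = 0.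
  rewrite -[RHS](linear0 (@vsval F _ (W_aspace F))) -k0 linear_sum.
  apply: eq_bigr => -[[|[|[|[|//]]]] ?] _; rewrite [RHS]linearZ /=;
    congr (_ *: _); apply: esym.
  - exact: vsval_W1.
  - exact: wpE.
  - exact: wqE.
  - exact: wrE.
have := congr1 (fun M : 'M[F]_4 => M (inord 0) (inord i)) k0'.
rewrite !big_ord_recl big_ord0 /= !mxE -!val_eqE /= !inordK //.
case: i {k0 k0'} => [[|[|[|[|//]]]] ilt] /=;
  rewrite !(mulr0, mulr1, add0r, addr0) => kE; rewrite -[RHS]kE;
  by congr k; apply: val_inj.
Qed.

Variable gT : finGroupType.

Definition W_nu1 (a b : gT) (cab : commute a b) : gstar gT (W F) :=
  four_gstar false false W_basis wp_sqr wq_sqr wpq wqp (mulr1 1) cab.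

Definition W_nu2 (a b : gT) (cab : commute a b) : gstar gT (W F) :=
  four_gstar true true W_basis wp_sqr wq_sqr wpq wqp (mulr1 1) cab.

Definition W_nu3 (a b : gT) (cab : commute a b) : gstar gT (W F) :=
  four_gstar true false W_basis wp_sqr wq_sqr wpq wqp (mulr1 1) cab.
End WStructure.

(* The multiplicities below lie between 0 and 2; the value 2 is reached exactly
   when both algebras are in the variety (e.g. by the subalgebra
   F.1 + (J(G2) x J(W)) of G2 x W), so "m = 1 iff P or Q" is true only for the
   exclusive disjunction. *)
Definition exactly_one (P Q : Prop) : Prop := (P /\ ~ Q) \/ (~ P /\ Q).

(* Main.v *)
(* If three elements of symmetric or skew components other than 1^+ had a
   nonzero product, substituting 1 for the variables of type 1^+ would make the
   m^3 monomials of P_{3m} with one such variable in each of three blocks of m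
   positions independent modulo Id(A); so quadratic growth kills these products.
   The identities c xy + d yx of A (x of type s, y of type t) are stable under
   exchanging c and d, by applying the involution, so they are spanned by those
   of xy + yx and xy - yx which are identities.
   Finally the four-dimensional algebra with relation q p = w p q lies in the
   variety iff xy + w yx is not an identity of A: given values x, y in A with
   xy + w yx <> 0, replace p by k x, q by l y and r = p q by the corresponding
   multiple of (xy + w yx)/2; comparing the coefficients of 1, k, l and k l shows
   that an identity of A vanishes in that algebra. *)
Require Import Defs.
From HB Require Import structures.
From mathcomp Require Import all_boot all_order all_algebra all_fingroup all_field.
From mathcomp Require Import boolp classical_sets reals.
From mathcomp Require Import finmap monalg.
From mathcomp Require Import zify ring lra.

Set Implicit Arguments.
Unset Strict Implicit.
Unset Printing Implicit Defensive.

Import Order.TTheory GRing.Theory Num.Theory.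
Local Open Scope classical_set_scope.
Local Open Scope ring_scope.

(** * Evaluation as an algebra morphism *)

Section Evaluation.
Variables (gT : finGroupType) (F : fieldType) (A : algType F).
Variable v : gvar gT -> A.

Definition word_eval (m : {fmonom (gvar gT)}) : A := \prod_(x <- m) v x.

Lemma word_eval_mmorphism : mmorphism word_eval.
Proof.
by split=> [m m'|]; rewrite /word_eval ?fmM ?big_cat // fm1 big_nil.
Qed.
HB.instance Definition _ := isMultiplicative.Build _ _ word_eval word_eval_mmorphism.

Lemma feval_linear : linear (feval v).
Proof.
move=> c f g; rewrite /feval mmapD -[fun m => _]/word_eval mmapZ.
by rewrite -mulr_algl.
Qed.
HB.instance Definition _ := GRing.isSemilinear.Build F (freealg gT F) A _ (feval v)
  (GRing.semilinear_linear feval_linear).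

(** The target is noncommutative, but coefficients are sent to scalars, which are central, so they
    move past the words. *)
Lemma feval_monoid_morphism : monoid_morphism (feval v).
Proof.
have [] : multiplicative (mmap (in_alg A) word_eval).
  apply: commr_mmap_is_multiplicative => f m m'.
  by apply: commr_sym; rewrite /GRing.comm mulr_algl mulr_algr.
by split.
Qed.
HB.instance Definition _ := GRing.isMonoidMorphism.Build (freealg gT F) A (feval v)
  feval_monoid_morphism.

Lemma fevalD f g : feval v (f + g) = feval v f + feval v g.
Proof. exact: linearD. Qed.

Lemma fevalZ c f : feval v (c *: f) = c *: feval v f.
Proof. exact: linearZ. Qed.

Lemma fevalM f g : feval v (f * g) = feval v f * feval v g.
Proof. exact: rmorphM. Qed.

Lemma feval_fvar i s : feval v (fvar F i s) = v (i, s).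
Proof. by rewrite /feval /fvar mmapU /= scale1r mul1r fmU big_seq1. Qed.

Lemma fevalE f : feval v f = \sum_(m <- msupp f) f@_m *: word_eval m.
Proof. by apply: eq_bigr => m _; rewrite -mulr_algl. Qed.
End Evaluation.

(** * Dimensions of quotients of vector spaces *)

Section QuotientDimension.
Variables (F : fieldType) (V : lmodType F).
Implicit Types U W : set V.

Definition subspace W :=
  W 0 /\ forall (c : F) x y, W x -> W y -> W (c *: x + y).

Lemma subspaceD W x y : subspace W -> W x -> W y -> W (x + y).
Proof. by case=> _ WP Wx Wy; rewrite -[x]scale1r; apply: WP. Qed.

Lemma subspaceZ W c x : subspace W -> W x -> W (c *: x).
Proof. by case=> W0 WP Wx; rewrite -[_ *: _]addr0; apply: WP. Qed.

Lemma subspace_sum W (I : Type) (r : seq I) (P : pred I) (x : I -> V) :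
  subspace W -> (forall i, P i -> W (x i)) -> W (\sum_(i <- r | P i) x i).
Proof.
move=> sW Wx; elim/big_rec: _ => [|i y Pi Wy]; first by case: sW.
by apply: subspaceD => //; apply: Wx.
Qed.

Lemma subspaceI U W : subspace U -> subspace W -> subspace (U `&` W).
Proof. by move=> [U0 UP] [W0 WP]; split=> // c x y [? ?] [? ?]; split; auto. Qed.

(** Writing each [x i] modulo [W] in terms of [b] gives a matrix with [#|I|] rows and [d] columns.
    With more rows than columns, a nonzero vector of its left kernel would be a relation among the
    [x i] modulo [W]. *)
Lemma leq_quot_basis U W d (b : 'I_d -> V) (I : finType) (x : I -> V) :
    subspace W -> quot_basis U (U `&` W) b -> (forall i, U (x i)) ->
    (forall c : I -> F, W (\sum_i c i *: x i) -> forall i, c i = 0) ->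
  (#|I| <= d)%N.
Proof.
move=> sW [_ _ span_b] Ux free_x.
have /choice[M MP] : forall i, exists c : 'I_d -> F, W (x i - \sum_j c j *: b j).
  by move=> i; have [c [_ ?]] := span_b _ (Ux i); exists c.
pose N : 'M[F]_(#|I|, d) := \matrix_(k, j) M (enum_val k) j.
rewrite leqNgt; apply/negP => dI.
have : kermx N != 0.
  rewrite kermx_eq0 /row_free neq_ltn (leq_ltn_trans _ dI) //.
  exact: rank_leq_col.
case/rowV0Pn => k /sub_kermxP kN /eqP[].
pose c i := k 0 (enum_rank i).
have c0 : forall i, c i = 0.
  apply: free_x.
  (* The subtracted combination of the [b j] has the coefficients of [k *m N], which are zero. *)
  have -> : \sum_i c i *: x i = \sum_i c i *: (x i - \sum_j M i j *: b j).
    rewrite -[LHS]subr0 [RHS](eq_bigr _ (fun i _ => scalerBr _ _ _)) sumrB.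
    congr (_ - _); under eq_bigr do rewrite scaler_sumr.
    rewrite exchange_big big1 //= => j _.
    under eq_bigr do rewrite scalerA.
    rewrite -scaler_suml; have /matrixP/(_ 0 j) := kN; rewrite !mxE => kNj.
    rewrite [X in X *: _](_ : _ = 0) ?scale0r // -[RHS]kNj.
    rewrite (reindex (@enum_val I I)) /=; last by apply: onW_bij; apply: enum_val_bij.
    by apply: eq_bigr => i _; rewrite mxE /c enum_valK.
  by apply: subspace_sum => // i _; apply: subspaceZ.
by apply/rowP => j; rewrite mxE -[j]enum_valK; apply: c0.
Qed.

Lemma quot_dim_eq U W d (b : 'I_d -> V) :
  subspace U -> subspace W -> quot_basis U (U `&` W) b -> quot_dim U W = d.
Proof.
move=> sU sW bP; rewrite /quot_dim.
case: xgetP => [d' _ [b' b'P]|/(_ d)[]]; last by exists b.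
have sUW := subspaceI sU sW.
have leqd d1 d2 (b1 : 'I_d1 -> V) (b2 : 'I_d2 -> V) : quot_basis U (U `&` W) b1 ->
    quot_basis U (U `&` W) b2 -> (d1 <= d2)%N.
  move=> [Ub1 free_b1 _] b2P; rewrite -[d1]card_ord.
  apply: (leq_quot_basis sW b2P Ub1) => c Wc.
  apply: free_b1; split=> //; apply: subspace_sum => // i _; exact: subspaceZ.
by apply/eqP; rewrite eqn_leq (leqd _ _ b' b) // (leqd _ _ b b').
Qed.

(** A relation modulo [W] holds term by term, so the [e i] outside [W] are independent modulo [W],
    and the others contribute nothing to the quotient. *)
Lemma quot_dim_separated U W (I : finType) (e : I -> V) :
    subspace W -> (forall u, U u <-> exists c, u = \sum_i c i *: e i) ->
    (forall c, W (\sum_i c i *: e i) -> forall i, W (c i *: e i)) ->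
  quot_dim U W = #|[pred i | `[< ~ W (e i) >]]|.
Proof.
move=> sW UE sep; pose b k := e (enum_val (A := [pred i | `[< ~ W (e i) >]]) k).
have sU : subspace U.
  split; first by apply/UE; exists (fun=> 0); rewrite big1 // => i _; rewrite scale0r.
  move=> c x y /UE[k ->] /UE[l ->]; apply/UE; exists (fun i => c * k i + l i).
  by rewrite scaler_sumr -big_split; apply: eq_bigr => i _; rewrite scalerDl scalerA.
have Ue i : U (e i).
  apply/UE; exists (fun j => (j == i)%:R).
  by rewrite (bigD1 i) //= eqxx scale1r big1 ?addr0 // => j /negPf->; rewrite scale0r.
apply: (quot_dim_eq (b := b)) => //; split=> [k|c [_ Wc] k|u /UE[c ->]].
- exact: Ue.
(* This is [c] extended by 0 to all of [I]. *)
- pose c' i := \sum_(l | enum_val (A := [pred i | `[< ~ W (e i) >]]) l == i) c l.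
  have c'E : c' (enum_val k) = c k.
    by apply: big_pred1 => l; rewrite /= (inj_eq enum_val_inj).
  have /sep/(_ (enum_val k)) : W (\sum_i c' i *: e i).
    rewrite (_ : \sum_i _ = \sum_l c l *: b l) //.
    rewrite [RHS](partition_big (fun l => enum_val l) xpredT) //=.
    apply: eq_bigr => i _; rewrite scaler_suml.
    by apply: eq_bigr => l /eqP li; rewrite /b li.
  rewrite c'E => Wck; apply/eqP/negP => /negP ck0.
  have /asboolP[] : enum_val k \in [pred i | `[< ~ W (e i) >]] by exact: enum_valP.
  by rewrite -[e _]scale1r -(mulVf ck0) -scalerA; apply: subspaceZ.
- exists (fun k => c (enum_val k)); rewrite -(big_enum_val (fun i => c i *: e i)).
  rewrite [X in X - _](bigID [pred i | `[< ~ W (e i) >]]) /= addrC addrK; split.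
    by apply: subspace_sum => // i _; apply: subspaceZ.
  apply: subspace_sum => // i /asboolPn/contrapT Wi; exact: subspaceZ.
Qed.
End QuotientDimension.

(** * The unit, the components and the involution *)

Section GradedInvolution.
Variables (gT : finGroupType) (F : fieldType) (A : algType F) (S : gstar gT A).

Lemma star1 : star S 1 = 1.
Proof. by have := starM S (star S 1) 1; rewrite mulr1 starK mulr1. Qed.

Lemma hcomp1 : hcomp S 1%g 1.
Proof.
have [f fS f1] := hcomp_sum S 1.
(* The component of degree 1 of 1 is a right identity. *)
have fE g : f g * f 1%g = f g.
  (* The [d k] are the homogeneous components of [f g * 1 - f g = 0], so each vanishes; the case
     [k = g] is the claim. *)
  pose d k := f g * f (g^-1 * k)%g - (k == g)%:R *: f g.
  have dS k : hcomp S k (d k).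
    rewrite /d addrC -scaleNr.
    have fgk : hcomp S k (f g * f (g^-1 * k)%g).
      by rewrite -{1}[k](mulKVg g); apply: hcompM.
    case: eqVneq fgk => [->|_] fgk; last by rewrite oppr0 scale0r add0r.
    by apply: hcompP.
  have := hcomp_direct dS _ g; rewrite /d eqxx scale1r mulVg => /(_ _)/subr0_eq; apply.
  rewrite sumrB -mulr_sumr (reindex_inj (mulgI g)) /=.
  under eq_bigr do rewrite mulKg.
  rewrite -f1 mulr1 (bigD1 g) //= eqxx scale1r big1 ?addr0 ?subrr // => k /negPf->.
  by rewrite scale0r.
suff -> : 1 = f 1%g by apply: fS.
by rewrite -[RHS]mul1r [in RHS]f1 mulr_suml {1}f1; apply: eq_bigr => g _; rewrite fE.
Qed.

Lemma hcomp_subspace g : subspace (hcomp S g).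
Proof. by split; [apply: hcomp0 | move=> c x y; apply: hcompP]. Qed.

Lemma sym_comp_subspace s : subspace (sym_comp S s).
Proof.
split; first by split; [apply: hcomp0 | rewrite linear0; case: ifP; rewrite ?oppr0].
move=> c x y [gx sx] [gy sy]; split; first exact: hcompP.
by rewrite linearP /= sx sy; case: ifP => // _; rewrite scalerN opprD.
Qed.

Lemma sym_comp1 : sym_comp S (1%g, true) 1.
Proof. by split; [apply: hcomp1 | apply: star1]. Qed.

Lemma Id_subspace : subspace (Id S).
Proof.
split=> [v _|c f1 f2 If1 If2 v vS]; first by rewrite linear0.
by rewrite linearP /= If1 // If2 // scaler0 addr0.
Qed.

Lemma star_sym s x : sym_comp S s x -> star S x = (-1) ^+ (~~ s.2) *: x.
Proof. by case=> _ ->; case: s.2; rewrite ?scale1r ?scaleN1r. Qed.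

(** The involution maps [x * y] to [e *: (y * x)] and [y * x] to [e *: (x * y)] with one and the
    same sign [e], which can be cancelled. *)
Lemma sym_comp_swap s t x y (c d : F) : sym_comp S s x -> sym_comp S t y ->
  c *: (x * y) + d *: (y * x) = 0 -> c *: (y * x) + d *: (x * y) = 0.
Proof.
move=> xS yS /(congr1 (star S)).
have [e e0 eE] : exists2 e : F, e != 0 & e = (-1) ^+ (~~ s.2) * (-1) ^+ (~~ t.2).
  by exists ((-1) ^+ (~~ s.2) * (-1) ^+ (~~ t.2)); rewrite // mulf_neq0 // signr_eq0.
have sxy : star S (x * y) = e *: (y * x).
  by rewrite starM (star_sym xS) (star_sym yS) -scalerAl -scalerAr scalerA eE mulrC.
have syx : star S (y * x) = e *: (x * y).
  by rewrite starM (star_sym xS) (star_sym yS) -scalerAl -scalerAr scalerA eE.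
rewrite linear0 linearD !linearZ /= sxy syx !scalerA ![_ * e]mulrC -!scalerA -scalerDr.
by move=> /eqP; rewrite scaler_eq0 (negPf e0) => /eqP.
Qed.
End GradedInvolution.

Lemma prodr_zero_factor (A : pzRingType) (I : eqType) (r : seq I) (f : I -> A) i :
  i \in r -> f i = 0 -> \prod_(j <- r) f j = 0.
Proof. by case/splitPr=> r1 r2 fi; rewrite big_cat big_cons /= fi mul0r mulr0. Qed.

Lemma prodr_single (A : pzRingType) n (i : 'I_n) (a : A) :
  \prod_(j < n) (if j == i then a else 1) = a.
Proof. by rewrite -big_mkcond big_pred1_eq. Qed.

(** * Quadratic growth kills triple products *)

Section CubicFamily.
Variables (gT : finGroupType) (F : fieldType) (A : algType F) (S : gstar gT A).
Variables (s1 s2 s3 : symb gT) (a1 a2 a3 : A).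
Hypotheses (s1N : s1 != (1%g, true)) (s2N : s2 != (1%g, true)) (s3N : s3 != (1%g, true)).
Hypotheses (a1S : sym_comp S s1 a1) (a2S : sym_comp S s2 a2) (a3S : sym_comp S s3 a3).
Hypothesis a123 : a1 * a2 * a3 != 0.
Variable m : nat.

(** With one choice in each of three separate blocks, the coordinates of [t] are independent and the
    family has exactly m^3 members. *)
Definition pick3 (T : Type) (t : 'I_m * 'I_m * 'I_m) (x1 x2 x3 x0 : T)
    (l : 'I_(m + m + m)) : T :=
  match split l with
  | inl k => match split k with
     | inl i => if i == t.1.1 then x1 else x0
     | inr j => if j == t.1.2 then x2 else x0 end
  | inr k => if k == t.2 then x3 else x0
  end.

Let w t := pick3 t s1 s2 s3 (1%g, true).

Definition cubic_monomial t : freealg gT F := \prod_l fvar F (l : 'I_(m + m + m)) (w t l).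

(* Variables which do not occur in [cubic_monomial t] go to 0, so this valuation
   kills every other monomial of the family. *)
Let val0 t (x : gvar gT) : A :=
  if insub x.1 is Some l then if x.2 == w t l then pick3 t a1 a2 a3 1 l else 0 else 0.

Let val0S t i s : sym_comp S s (val0 t (i, s)).
Proof.
rewrite /val0 /=; have z := (sym_comp_subspace S s).1.
case: insubP => //= l _ _; case: eqP => // ->; rewrite /w /pick3.
have o := sym_comp1 S.
by case: split => k; [case: split => k' |]; case: eqP.
Qed.

Let feval_cubic t t' :
  feval (val0 t) (cubic_monomial t') =
  \prod_l if w t' l == w t l then pick3 t a1 a2 a3 1 l else 0.
Proof.
rewrite rmorph_prod; apply: eq_bigr => l _.
by rewrite /= feval_fvar /val0 /= valK.
Qed.

Let lsplit (k : 'I_(m + m)) : split (lshift m k) = inl k.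
Proof. exact: (unsplitK (inl _ k)). Qed.
Let rsplit n (k : 'I_m) : split (rshift n k) = inr k.
Proof. exact: (unsplitK (inr _ k)). Qed.
Let llsplit (k : 'I_m) : split (lshift m k) = inl k.
Proof. exact: (unsplitK (inl _ k)). Qed.

Let feval_cubic_eq t : feval (val0 t) (cubic_monomial t) = a1 * a2 * a3.
Proof.
rewrite feval_cubic; under eq_bigr do rewrite eqxx.
rewrite !big_split_ord /=; congr (_ * _ * _);
  [rewrite -[RHS](prodr_single t.1.1) | rewrite -[RHS](prodr_single t.1.2)
  | rewrite -[RHS](prodr_single t.2)];
  by apply: eq_bigr => i _; rewrite /pick3 ?(lsplit, rsplit, llsplit).
Qed.

Let feval_cubic_neq t t' : t' != t -> feval (val0 t) (cubic_monomial t') = 0.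
Proof.
move=> tt; rewrite feval_cubic.
(* At a position chosen by [t'] but not by [t], the first symbol is some [s_i] and the second is
   1^+. *)
have [l wl] : exists l, w t' l != w t l.
  case: t t' tt => [[i j] k] [[i' j'] k']; rewrite !xpair_eqE !negb_and -orbA.
  case/or3P => ne; [exists (lshift m (lshift m i')) | exists (lshift m (rshift m j'))
    | exists (rshift (m + m) k')];
  by rewrite /w /pick3 ?(lsplit, rsplit, llsplit) /= eqxx (negPf ne).
by apply: (@prodr_zero_factor _ _ _ _ l); rewrite ?mem_index_enum // (negPf wl).
Qed.

(** Evaluating at [val0 t] leaves only [c t *: (a1 * a2 * a3)]. *)
Lemma cubic_monomial_free (c : 'I_m * 'I_m * 'I_m -> F) :
  Id S (\sum_t c t *: cubic_monomial t) -> forall t, c t = 0.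
Proof.
move=> Ic t; have /eqP := Ic _ (@val0S t).
rewrite linear_sum (bigD1 t) //= big1 ?addr0.
  by rewrite linearZ /= feval_cubic_eq scaler_eq0 (negPf a123) orbF => /eqP.
by move=> t' tt; rewrite linearZ /= feval_cubic_neq // scaler0.
Qed.

(** The value 0 is also the default of [quot_dim]; a nonzero value guarantees a genuine basis to
    compare the monomials with. *)
Lemma codim_cubic : codim S (m + m + m) != 0%N -> (m ^ 3 <= codim S (m + m + m))%N.
Proof.
rewrite /codim /quot_dim; case: xgetP => // d _ [b bP] _.
have -> : (m ^ 3 = #|{: 'I_m * 'I_m * 'I_m}|)%N by rewrite !card_prod !card_ord; ring.
apply: leq_quot_basis (Id_subspace S) bP _ cubic_monomial_free => t.
exists 1%N, (fun=> 1), (fun=> cubic_monomial t); split=> [_|]; last first.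
  by rewrite big_ord1 scale1r.
exists 1%g, (w t); apply: eq_bigr => l _; by rewrite perm1.
Qed.
End CubicFamily.

Lemma quadratic_growth_mul3 (R : realType) (gT : finGroupType) (F : fieldType)
    (A : algType F) (S : gstar gT A) (s1 s2 s3 : symb gT) (a1 a2 a3 : A) :
    quadratic_growth R S ->
    s1 != (1%g, true) -> s2 != (1%g, true) -> s3 != (1%g, true) ->
    sym_comp S s1 a1 -> sym_comp S s2 a2 -> sym_comp S s3 a3 ->
  a1 * a2 * a3 = 0.
Proof.
move=> [q q0 [C [N growth]]] s1N s2N s3N a1S a2S a3S; apply/eqP/negPn/negP => a123.
(* For m > B, the first two terms give m^3 > 9 q m^2 + 3 |C| m, against the upper bound at n = 3m;
   the last gives q m > |C|, so that the lower bound excludes codimension 0. *)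
pose B := 9 * q + 3 * `|C| + `|C| / q.
have C0 := normr_ge0 C; have CC := ler_norm C.
have CqE : `|C| / q * q = `|C| by rewrite divfK ?gt_eqF.
have Cq0 : 0 <= `|C| / q by rewrite divr_ge0 // ltW.
have B0 : 0 <= B by rewrite /B; nra.
have := archi_boundP B0; set b := Num.bound B => Bb.
have /growth : (N <= (N + b) + (N + b) + (N + b))%N by lia.
have : b%:R <= (N + b)%:R :> R by rewrite ler_nat leq_addl.
move: (N + b)%N => m bm.
have := codim_cubic s1N s2N s3N a1S a2S a3S a123 (m := m).
rewrite ler_norml !natrD; move: (codim _ _) => c cm /andP[cl cu].
set M := m%:R in cl cu bm *.
have MB : B < M by lra.
have M0 : 0 < M by lra.
have CM : C * (M + M + M) <= 3 * `|C| * M by nra.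
have [c0|c0] := eqVneq c 0%N.
  have CM' : `|C| < M * q by rewrite -{}CqE ltr_pM2r //; rewrite /B in MB; lra.
  have h1 : M * `|C| < M * (M * q) by rewrite ltr_pM2l.
  have h2 : 0 < M * (M * q) by rewrite !mulr_gt0.
  by move: cl; rewrite c0 mulr0n; lra.
have M1 : 1 <= M by rewrite ler1n -(ltr0n R).
have h1 : M ^+ 3 <= c%:R by rewrite -natrX ler_nat; apply: cm.
have h2 : M * M * (9 * q + 3 * `|C|) < M * M * M.
  by rewrite ltr_pM2l ?mulr_gt0 //; rewrite /B in MB; lra.
have h3 : M * `|C| <= M * (M * `|C|) by rewrite ler_pM2l // ler_peMl.
lra.
Qed.

(** * Noncommutative polynomials truncated above degree 2 *)

Section Truncation.
Variables (F : fieldType) (I : finType).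

Section Algebra.
Variables (A : algType F) (z : I -> A).

(** The coefficients are separate from the values [z], so that the same polynomial can be read in
    two algebras. *)
Definition trunc (c : F) (l : I -> F) (d : I -> I -> F) : A :=
  c%:A + \sum_i l i *: z i + \sum_i \sum_j d i j *: (z i * z j).

Lemma trunc_linear k c l d c' l' d' :
  k *: trunc c l d + trunc c' l' d' =
  trunc (k * c + c') (fun i => k * l i + l' i) (fun i j => k * d i j + d' i j).
Proof.
rewrite /trunc !scalerDr scalerA scalerDl addrACA.
congr (_ + _); first rewrite addrACA; first congr (_ + _).
  by rewrite scaler_sumr -big_split; apply: eq_bigr => i _; rewrite scalerDl scalerA.
rewrite scaler_sumr -big_split; apply: eq_bigr => i _ /=.
by rewrite scaler_sumr -big_split; apply: eq_bigr => j _; rewrite scalerDl scalerA.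
Qed.

Lemma trunc_scalar c : trunc c (fun=> 0) (fun=> fun=> 0) = c%:A.
Proof.
by rewrite /trunc !big1 ?addr0 // => i _; rewrite ?big1 ?scale0r // => j _; rewrite scale0r.
Qed.

Hypothesis z3 : forall i j k, z i * z j * z k = 0.

Lemma truncM c l d c' l' d' :
  trunc c l d * trunc c' l' d' =
  trunc (c * c') (fun i => c * l' i + c' * l i)
    (fun i j => c * d' i j + c' * d i j + l i * l' j).
Proof.
pose L := \sum_i l i *: z i; pose L' := \sum_i l' i *: z i.
pose D := \sum_i \sum_j d i j *: (z i * z j).
pose D' := \sum_i \sum_j d' i j *: (z i * z j).
have LD : L * D' = 0.
  rewrite mulr_suml big1 // => i _; rewrite mulr_sumr big1 // => j _.
  rewrite mulr_sumr big1 // => k _.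
  by rewrite -scalerAl -scalerAr mulrA z3 !scaler0.
have Dz k x : D * (z k * x) = 0.
  rewrite mulr_suml big1 // => i _; rewrite mulr_suml big1 // => j _.
  by rewrite -scalerAl mulrA z3 mul0r scaler0.
have DL : D * L' = 0.
  by rewrite mulr_sumr big1 // => k _; rewrite -scalerAr -[z k]mulr1 Dz scaler0.
have DD : D * D' = 0.
  rewrite mulr_sumr big1 // => k _; rewrite mulr_sumr big1 // => j _.
  by rewrite -scalerAr Dz scaler0.
have LL : L * L' = \sum_i \sum_j (l i * l' j) *: (z i * z j).
  rewrite mulr_suml; apply: eq_bigr => i _; rewrite mulr_sumr; apply: eq_bigr => j _.
  by rewrite -scalerAl -scalerAr scalerA.
rewrite {1 2}/trunc -/L -/L' -/D -/D' !mulrDl !mulrDr !mulr_algl !mulr_algr.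
rewrite LD DL DD !addr0 LL.
rewrite addrA [LHS](ACl (1 * (2 * 4) * (3 * 6 * 5))) /= /trunc scalerA.
congr (_ + _ + _).
  by rewrite !scaler_sumr -big_split; apply: eq_bigr => i _; rewrite /= scalerDl !scalerA.
rewrite !scaler_sumr -!big_split; apply: eq_bigr => i _ /=.
by rewrite !scaler_sumr -!big_split; apply: eq_bigr => j _; rewrite /= !scalerDl !scalerA.
Qed.
End Algebra.

(* The truncated polynomial obtained by evaluating [f] at truncated polynomials
   does not depend on the algebra. *)
Lemma feval_trunc (gT : finGroupType) (c : gvar gT -> F) (l : gvar gT -> I -> F)
    (d : gvar gT -> I -> I -> F) (f : freealg gT F) :
  exists c0 l0 d0, forall (A : algType F) (z : I -> A),
    (forall i j k, z i * z j * z k = 0) ->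
  feval (fun x => trunc z (c x) (l x) (d x)) f = trunc z c0 l0 d0.
Proof.
pose v (A : algType F) (z : I -> A) x := trunc z (c x) (l x) (d x).
have words (m : seq (gvar gT)) : exists c0 l0 d0, forall (A : algType F) (z : I -> A),
    (forall i j k, z i * z j * z k = 0) -> \prod_(x <- m) v A z x = trunc z c0 l0 d0.
  elim: m => [|x m [c0 [l0 [d0 IHm]]]].
    by exists 1, (fun=> 0), (fun=> fun=> 0) => A z z3; rewrite big_nil trunc_scalar scale1r.
  by eexists; eexists; eexists => A z z3; rewrite big_cons IHm // truncM.
suff [c0 [l0 [d0 E]]] : exists c0 l0 d0, forall (A : algType F) (z : I -> A),
    (forall i j k, z i * z j * z k = 0) ->
    \sum_(m <- msupp f) f@_m *: word_eval (v A z) m = trunc z c0 l0 d0.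
  by exists c0, l0, d0 => A z z3; rewrite fevalE E.
elim: (enum_fset (msupp f)) => [|m r [c0 [l0 [d0 IHr]]]].
  by exists 0, (fun=> 0), (fun=> fun=> 0) => A z z3; rewrite big_nil trunc_scalar scale0r.
have [c1 [l1 [d1 E]]] := words m.
by eexists; eexists; eexists => A z z3; rewrite big_cons IHr // /word_eval E // trunc_linear.
Qed.
End Truncation.

(** The commutator for [w = -1], the anticommutator for [w = 1]. *)
Definition twisted (gT : finGroupType) (F : fieldType) (s t : symb gT) (w : F) :
    freealg gT F :=
  fvar F 0 s * fvar F 1 t + w *: (fvar F 1 t * fvar F 0 s).

Lemma feval_twisted (gT : finGroupType) (F : fieldType) (s t : symb gT) (w : F)
    (A : algType F) (v : gvar gT -> A) :
  feval v (twisted s t w) = v (0%N, s) * v (1%N, t) + w *: (v (1%N, t) * v (0%N, s)).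
Proof.
rewrite fevalD fevalZ.
by congr (_ + _ *: _); rewrite fevalM (feval_fvar v 0) (feval_fvar v 1).
Qed.

(** * When a four-dimensional algebra lies in the variety *)

Section FourDimVariety.
Variables (gT : finGroupType) (F : fieldType) (A : algType F) (S : gstar gT A).
Hypothesis two_neq0 : 2%:R != 0 :> F.
Hypothesis mul3 : forall (s1 s2 s3 : symb gT) (a1 a2 a3 : A),
  s1 != (1%g, true) -> s2 != (1%g, true) -> s3 != (1%g, true) ->
  sym_comp S s1 a1 -> sym_comp S s2 a2 -> sym_comp S s3 a3 -> a1 * a2 * a3 = 0.

Variables (B : falgType F) (p q r : B) (w : F) (a b : gT) (s1 s2 : bool).
Hypotheses (Xbasis : basis_of fullv (four_basis p q r)).
Hypotheses (pp : p * p = 0) (qq : q * q = 0) (pq : p * q = r) (qp : q * p = w *: r).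
Hypotheses (ww : w * w = 1) (cab : commute a b).
Let T := four_gstar s1 s2 Xbasis pp qq pq qp ww cab.
Let X := four_basis p q r.
Let s : symb gT := (a, ~~ s1).
Let t : symb gT := (b, ~~ s2).
Hypotheses (sN : s != (1%g, true)) (tN : t != (1%g, true)).

(** The basis vectors are homogeneous eigenvectors of the involution, so only those of matching
    degree and sign can occur in [y]. *)
Lemma coord_sym (i : 'I_4) (x : symb gT) (y : B) : sym_comp T x y -> coord X i y != 0 ->
  four_deg a b i = x.1 /\ four_sign w s1 s2 i = (-1) ^+ (~~ x.2).
Proof.
move=> yS; have [[c yE] _] := yS => ci.
have Xfree := basis_free Xbasis.
have coordE (k : 'I_4 -> F) : coord X i (\sum_j k j *: X`_j) = k i by apply: coord_sum_free.
split.
  apply/eqP/negPn/negP => di; move: ci; rewrite yE big_mkcond /=.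
  rewrite (_ : \sum_j _ = \sum_j (if four_deg a b j == x.1 then c j else 0) *: X`_j).
    by rewrite coordE (negPf di) eqxx.
  by apply: eq_bigr => j _; case: ifP; rewrite ?scale0r.
apply: (mulfI ci); rewrite [RHS]mulrC -linearZ -(star_sym yS).
rewrite -[star T y]/(\sum_j coord X j y *: (four_sign w s1 s2 j *: X`_j)).
under eq_bigr do rewrite scalerA.
by rewrite /= (coordE (fun j => coord X j y * four_sign w s1 s2 j)).
Qed.

Lemma four_sum_ord (c : 'I_4 -> B) :
  \sum_i c i = c (@Ordinal 4 0 isT) + c (@Ordinal 4 1 isT) + c (@Ordinal 4 2 isT)
    + c (@Ordinal 4 3 isT).
Proof.
rewrite !big_ord_recl big_ord0 addr0 !addrA.
by congr (c _ + c _ + c _ + c _); apply: val_inj.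
Qed.

Let lc (y : B) (i : bool) : F :=
  coord X (if i then @Ordinal 4 1 isT else @Ordinal 4 2 isT) y.
(* The multiple of r is split as r = (p q + w q p) / 2, whose analogue in any
   algebra with involution is symmetric or skew. *)
Let dc (y : B) (i j : bool) : F :=
  if i == j then 0 else (if i then 1 else w) * (coord X (@Ordinal 4 3 isT) y / 2%:R).

Lemma trunc_four y :
  trunc (fun i => if i then p else q) (coord X (@Ordinal 4 0 isT) y) (lc y) (dc y) = y.
Proof.
rewrite [RHS](coord_basis Xbasis (memvf y)) four_sum_ord /trunc !big_bool /=.
rewrite /dc /= !scale0r !add0r addr0 pq qp scalerA -scalerDl !addrA.
congr (_ + _ *: _); rewrite mul1r mulrAC ww mul1r -mulrDl.
by rewrite -mulr2n -[_ *+ 2]mulr_natr mulfK.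
Qed.

Lemma four_mul3 (i j k : bool) :
  let z i := if i then p else q in z i * z j * z k = 0.
Proof.
case: i j k => [] [] [] /=; rewrite ?pp ?qq ?mul0r //.
- by rewrite -mulrA qp -scalerAr -pq mulrA pp mul0r scaler0.
- by rewrite -mulrA qq mulr0.
- by rewrite -mulrA pp mulr0.
- by rewrite qp -scalerAl -pq -mulrA qq mulr0 scaler0.
Qed.

Lemma basis_hcompX n (Y : n.-tuple B) (d : 'I_n -> gT) i : basis_hcomp Y d (d i) Y`_i.
Proof.
exists (fun j => (j == i)%:R); rewrite (bigD1 i) //= eqxx scale1r big1 ?addr0 //.
by move=> j /andP[_ /negPf->]; rewrite scale0r.
Qed.

Lemma four_symP : sym_comp T s p.
Proof.
split; first exact: (@basis_hcompX _ X (four_deg a b) (@Ordinal 4 1 isT)).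
by rewrite four_star_p /=; case: s1; rewrite ?scale1r ?scaleN1r.
Qed.

Lemma four_symQ : sym_comp T t q.
Proof.
split; first exact: (@basis_hcompX _ X (four_deg a b) (@Ordinal 4 2 isT)).
by rewrite four_star_q /=; case: s2; rewrite ?scale1r ?scaleN1r.
Qed.

(** At [p] and [q] the value is [r + (w * w) *: r], twice a basis vector. *)
Lemma twisted_notin_Id : ~ Id T (twisted s t w).
Proof.
move=> /(_ (fun x => if x == (0%N, s) then p else if x == (1%N, t) then q else 0)).
rewrite feval_twisted /= !eqxx /= pq qp scalerA ww scale1r => Tw.
have r0 : r != 0 by apply: (free_not0 (basis_free Xbasis)); rewrite !inE eqxx !orbT.
have /eqP[] : r + r != 0 by rewrite -mulr2n -scaler_nat scaler_eq0 negb_or two_neq0.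
apply: Tw => i x; case: eqP => [[_ ->]|_]; first exact: four_symP.
by case: eqP => [[_ ->]|_]; [exact: four_symQ | exact: (sym_comp_subspace T x).1].
Qed.

Lemma in_var_four : in_var S T <-> ~ Id S (twisted s t w).
Proof.
split=> [ST /ST|]; first exact: twisted_notin_Id.
move=> /existsNP[v0 /not_implyP[v0S /eqP]].
rewrite feval_twisted; set x := v0 _; set y := v0 _ => xy0 f Sf v vT.
have xS : sym_comp S s x by apply: v0S.
have yS : sym_comp S t y by apply: v0S.
have [c0 [l0 [d0 E]]] := feval_trunc (fun i => coord X (@Ordinal 4 0 isT) (v i))
  (fun i => lc (v i)) (fun i => dc (v i)) f.
have -> : v = fun i => trunc (fun j => if j then p else q)
    (coord X (@Ordinal 4 0 isT) (v i)) (lc (v i)) (dc (v i)).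
  by apply: funext => i; rewrite trunc_four.
rewrite E; last exact: four_mul3.
(* Replacing [p], [q] by [k *: x], [l *: y] in the values of [v] gives an admissible valuation in
   [A], where [f] vanishes; the coefficients of its value are unchanged. *)
have E' (k l : F) : trunc (fun j : bool => if j then k *: x else l *: y) c0 l0 d0 = 0.
  have kxS := subspaceZ k (sym_comp_subspace S s) xS.
  have lyS := subspaceZ l (sym_comp_subspace S t) yS.
  rewrite -E; last first.
    by move=> i j i'; apply: (@mul3 (if i then s else t) (if j then s else t)
      (if i' then s else t)); case: ifP.
  apply: Sf => n z; set y' := v _.
  have zS := sym_comp_subspace S z.
  have cS (i : 'I_4) (u : A) : hcomp S (four_deg a b i) u ->
      star S u = four_sign w s1 s2 i *: u -> sym_comp S z (coord X i y' *: u).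
    have [->|] := eqVneq (coord X i y') 0; first by rewrite scale0r => _ _; exact: zS.1.
    move=> /(coord_sym (vT n z))[-> ->] uS su; apply: subspaceZ => //.
    by split=> //; rewrite su; case: z.2; rewrite ?scale1r ?scaleN1r.
  rewrite /trunc !big_bool /= /lc /dc /= !scale0r add0r addr0.
  have -> (m : F) (u u' : A) : (1 * (m / 2%:R)) *: u + (w * (m / 2%:R)) *: u' =
      m *: (2%:R^-1 *: (u + w *: u')).
    by rewrite !scalerDr !scalerA mul1r [w * _]mulrC ?mulrA.
  have h0 : sym_comp S z (coord X (@Ordinal 4 0 isT) y' *: 1).
    by apply: cS; [exact: hcomp1 | rewrite star1 scale1r].
  have h1 : sym_comp S z (coord X (@Ordinal 4 1 isT) y' *: (k *: x)).
    by apply: cS; [exact: kxS.1 | rewrite (star_sym kxS) /= negbK].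
  have h2 : sym_comp S z (coord X (@Ordinal 4 2 isT) y' *: (l *: y)).
    by apply: cS; [exact: lyS.1 | rewrite (star_sym lyS) /= negbK].
  apply: subspaceD => //; first by apply: subspaceD => //; apply: subspaceD.
  apply: cS.
    apply: subspaceZ; first exact: hcomp_subspace.
    apply: subspaceD; first exact: hcomp_subspace.
      exact: hcompM kxS.1 lyS.1.
    apply: subspaceZ; first exact: hcomp_subspace.
    (* The product in reverse order has degree [b * a], equal to [a * b] by commutation. *)
    by rewrite [four_deg _ _ _]cab; apply: hcompM lyS.1 kxS.1.
  (* The involution exchanges the two products, and [w * w = 1] makes xy + w yx an eigenvector with
     the sign of [r]. *)
  rewrite [LHS]linearZ linearD linearZ /= !starM (star_sym kxS) (star_sym lyS) /= !negbK.
  rewrite -!(scalerAl, scalerAr) !scalerDr !scalerA addrC /four_sign /=.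
  move: (2%:R^-1 : F) ((-1) ^+ s1 : F) ((-1) ^+ s2 : F) => m e e'.
  by congr (_ *: _ + _ *: _); ring: ww.
have xn0 : x != 0 by apply: contra xy0 => /eqP->; rewrite mul0r mulr0 scaler0 addr0.
have yn0 : y != 0 by apply: contra xy0 => /eqP->; rewrite mul0r mulr0 scaler0 addr0.
have c00 : c0 = 0.
  have := E' 0 0; rewrite /trunc !big_bool /= !(scale0r, mul0r, scaler0, addr0) => /eqP.
  by rewrite scaler_eq0 oner_eq0 orbF => /eqP.
have add_sub0 (u u' : A) : u + u' = 0 -> - u + u' = 0 -> u = 0 /\ u' = 0.
  move=> uu' uNu'; suff u'0 : u' = 0 by move: uu'; rewrite u'0 addr0.
  have /eqP := congr2 +%R uu' uNu'; rewrite addrACA subrr add0r addr0 -mulr2n -scaler_nat.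
  by rewrite scaler_eq0 (negPf two_neq0) => /eqP.
(* The values 1 and -1 of [k] separate the linear from the quadratic part, as 2 is invertible. *)
have [lx0 dx0] : l0 true *: x = 0 /\ d0 true true *: (x * x) = 0.
  have := E' 1 0; have := E' (-1) 0.
  rewrite /trunc !big_bool /= c00 !(scale0r, mul0r, mulr0, scaler0, addr0, add0r).
  rewrite !scale1r !scaleN1r mulrNN scalerN => h1 h2; exact: add_sub0.
have [ly0 dy0] : l0 false *: y = 0 /\ d0 false false *: (y * y) = 0.
  have := E' 0 1; have := E' 0 (-1).
  rewrite /trunc !big_bool /= c00 !(scale0r, mul0r, mulr0, scaler0, addr0, add0r).
  rewrite !scale1r !scaleN1r mulrNN scalerN => h1 h2; exact: add_sub0.
have dE : d0 true false *: (x * y) + d0 false true *: (y * x) = 0.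
  have := E' 1 1; rewrite /trunc !big_bool /= c00 !scale1r.
  by rewrite lx0 dx0 ly0 dy0 !(scale0r, addr0, add0r).
have l0t : l0 true = 0 by move/eqP: lx0; rewrite scaler_eq0 (negPf xn0) orbF => /eqP.
have l0f : l0 false = 0 by move/eqP: ly0; rewrite scaler_eq0 (negPf yn0) orbF => /eqP.
rewrite /trunc !big_bool /= pp qq pq qp c00 l0t l0f.
rewrite !scale0r !scaler0 !addr0 !add0r scalerA -scalerDl.
suff /eqP : (d0 true false + d0 false true * w) *: (x * y + w *: (y * x)) = 0.
  by rewrite scaler_eq0 (negPf xy0) orbF => /eqP->; rewrite scale0r.
(* The relation [dE] plus [w] times its mirror image factors through xy + w yx. *)
have dE' := sym_comp_swap xS yS dE.
have := congr2 (fun u u' => u + w *: u') dE dE'.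
rewrite scaler0 addr0 => <-.
rewrite !scalerDr !scalerA [w * _ *: _ + _]addrC addrACA -!scalerDl.
congr (_ *: _ + _ *: _); ring: ww.
Qed.
End FourDimVariety.

(** * Multilinear proper polynomials in two variables and the multiplicity *)

Lemma combine_commutator (F : fieldType) (V : lmodType F) (c d : F) (u u' : V) :
  c *: u + d *: u' = (c + d) *: u + (- d) *: (u - u').
Proof.
by rewrite scalerDl scaleNr scalerBr opprB addrACA subrr addr0.
Qed.

Section Gamma11.
Variables (gT : finGroupType) (F : fieldType) (s t : symb gT).
Hypotheses (sN : s != (1%g, true)) (tN : t != (1%g, true)).

Let x : freealg gT F := fvar F 0 s.
Let y : freealg gT F := fvar F 1 t.
Let xy : {fmonom (gvar gT)} := mmul (fmu (0%N, s)) (fmu (1%N, t)).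
Let yx : {fmonom (gvar gT)} := mmul (fmu (1%N, t)) (fmu (0%N, s)).

Let coefE (c d : F) (m : {fmonom (gvar gT)}) :
  (c *: (x * y) + d *: (y * x))@_m = c * (xy == m)%:R + d * (yx == m)%:R.
Proof.
have xyE : x * y = << xy >> by rewrite malgM_def fgmulUU mulr1.
have yxE : y * x = << yx >> by rewrite malgM_def fgmulUU mulr1.
by rewrite mcoeffD; congr (_ + _); rewrite mcoeffZ ?xyE ?yxE mcoeffU1.
Qed.

Let proper_xy_yx (c d : F) : @Defs.proper gT F (c *: (x * y) + d *: (y * x)).
Proof.
(* The proper form is c xy + d yx = (c + d) xy - d [x, y]. *)
exists 2, (fun i => if i == ord0 then c + d else - d),
  (fun i => if i == ord0 then x * y else Defs.commutator x y); split=> [i|].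
  case: eqP => _; last first.
    exists 1%N, (fun=> Defs.commutator x y); rewrite big_ord1; split=> // _.
    by left; apply: LongComm2.
  exists 2, (fun i => if i == ord0 then x else y); rewrite !big_ord_recl big_ord0 /= mulr1.
  by split=> // j; right; case: eqP => _; [exists 0%N, s | exists 1%N, t].
rewrite !big_ord_recl big_ord0 /= addr0; exact: combine_commutator.
Qed.

(** Neither symbol is 1^+, so both variables are proper factors and properness excludes nothing;
    multilinearity leaves only the monomials xy and yx. *)
Lemma Gamma11P (f : freealg gT F) :
  @Gamma11 gT F s t f <-> exists c d, f = c *: (x * y) + d *: (y * x).
Proof.
split=> [[_ fm]|[c [d ->]]]; last first.
  split; first exact: proper_xy_yx.
  move=> m; rewrite coefE.
  have [<- _|_] := eqVneq xy m; first by rewrite fmM !fmU.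
  have [<- _|_] := eqVneq yx m; first by rewrite fmM !fmU (perm_catC [:: _] [:: _]).
  by rewrite !mulr0 addr0 eqxx.
exists f@_xy, f@_yx; apply/malgP => m; rewrite coefE.
have xyN : (xy == yx) = false by rewrite fmP !fmM !fmU.
have [<-|xym] := eqVneq xy m; first by rewrite eq_sym xyN mulr0 mulr1 addr0.
have [<-|yxm] := eqVneq yx m; first by rewrite mulr0 mulr1 add0r.
rewrite !mulr0 addr0; apply/eqP/negPn/negP => /fm mP.
move: xym yxm; rewrite !fmP !fmM !fmU.
move: (perm_size mP) (perm_mem mP) (mP); case: (m : seq _) => [|u [|v [|]]] //= _.
move=> /(_ u); rewrite !inE eqxx /= => /esym/orP[]/eqP->.
  by rewrite perm_cons => /perm_small_eq ->; rewrite ?eqxx.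
rewrite perm_sym (perm_catC [:: _] [:: _]) perm_cons perm_sym.
by move=> /perm_small_eq ->; rewrite ?eqxx.
Qed.
End Gamma11.

Lemma sum_twisted (F : fieldType) (V : lmodType F) (k : bool -> F) (u u' : V) :
  \sum_i k i *: (u + (if i then -1 else 1) *: u') =
  (k true + k false) *: u + (k false - k true) *: u'.
Proof.
rewrite big_bool /= !scalerDr !scalerA mulrN !mulr1 addrACA -!scalerDl.
by rewrite [- _ + _]addrC.
Qed.

Lemma twisted_span (F : fieldType) (V : lmodType F) (c d : F) (u u' : V) :
  2%:R != 0 :> F ->
  c *: u + d *: u' = \sum_i (if i then (c - d) / 2%:R else (c + d) / 2%:R)
    *: (u + (if i then -1 else 1) *: u').
Proof. by move=> two_neq0; rewrite sum_twisted; congr (_ *: _ + _ *: _); field. Qed.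

(** The commutator and anticommutator parts of an identity are identities themselves, so the
    dimension counts those of the two that are not identities. *)
Lemma mult11E (gT : finGroupType) (F : fieldType) (A : algType F) (S : gstar gT A)
    (s t : symb gT) :
    2%:R != 0 :> F -> s != (1%g, true) -> t != (1%g, true) ->
  mult11 S s t = #|[pred i : bool | `[< ~ Id S (twisted s t (if i then -1 else 1)) >]]|.
Proof.
move=> two_neq0 sN tN; apply: quot_dim_separated; first exact: Id_subspace.
  move=> f; rewrite (Gamma11P sN tN); split=> [[c [d ->]]|[k ->]]; last first.
    by rewrite sum_twisted; do 2!eexists.
  by exists (fun i => if i then (c - d) / 2%:R else (c + d) / 2%:R); apply: twisted_span.
move=> k; rewrite sum_twisted => Ik i v vS.
have xS : sym_comp S s (v (0%N, s)) by [].
have yS : sym_comp S t (v (1%N, t)) by [].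
have kE : (k true + k false) *: (v (0%N, s) * v (1%N, t)) +
    (k false - k true) *: (v (1%N, t) * v (0%N, s)) = 0.
  rewrite -[RHS](Ik v vS) fevalD.
  by congr (_ + _); rewrite fevalZ fevalM (feval_fvar v 0) (feval_fvar v 1).
have kE' := sym_comp_swap xS yS kE.
rewrite fevalZ feval_twisted; apply: (scalerI two_neq0); rewrite scaler0.
(* Adding the mirrored relation, or subtracting it, leaves [2 * k i] times the part of index [i]. *)
have := congr2 (fun u u' => u + (if i then -1 else 1) *: u') kE kE'.
rewrite scaler0 addr0 => <-; rewrite !scalerDr !scalerA.
rewrite [RHS](AC (2*2) ((1*4)*(2*3))) /= -!scalerDl.
by case: i; congr (_ *: _ + _ *: _); ring.
Qed.

Lemma card_exactly_one (X : bool -> Prop) (P Q : Prop) :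
  (P <-> ~ X true) -> (Q <-> ~ X false) ->
  #|[pred i | `[< ~ X i >]]| = 1%N <-> exactly_one P Q.
Proof.
move=> PE QE; rewrite -sum1_card big_mkcond big_bool /= !inE.
rewrite /exactly_one (propext PE) (propext QE).
by case: asboolP => ?; case: asboolP => ?; split=> // *; tauto.
Qed.

Lemma mult11_eq1 (gT : finGroupType) (F : fieldType) (A : algType F) (S : gstar gT A)
    (s t : symb gT) (P Q : Prop) :
    2%:R != 0 :> F -> s != (1%g, true) -> t != (1%g, true) ->
    (P <-> ~ Id S (twisted s t (-1))) -> (Q <-> ~ Id S (twisted s t 1)) ->
  mult11 S s t = 1%N <-> exactly_one P Q.
Proof. by move=> ? ? ? PE QE; rewrite mult11E //; apply: card_exactly_one PE QE. Qed.

Theorem lemma4p5 (R : realType) (F : fieldType) (charF : [pchar F] =i pred0)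
    (gT : finGroupType) (A : algType F) (S : gstar gT A)
    (growth : quadratic_growth R S) (typeA : type_FJ A)
    (g h u : gT) (g_neq1 : g != 1%g) (h_neq1 : h != 1%g)
    (g_neq_h : g != h) (h_neq_u : h != u) :
  [/\ forall cgh : commute g h,
        mult11 S (g, true) (h, true) = 1%N <->
        exactly_one (in_var S (G2_psi F cgh)) (in_var S (W_nu1 F cgh)),
      forall cuh : commute u h,
        mult11 S (u, false) (h, false) = 1%N <->
        exactly_one (in_var S (G2_tau F cuh)) (in_var S (W_nu2 F cuh))
    & forall cug : commute u g,
        mult11 S (u, false) (g, true) = 1%N <->
        exactly_one (in_var S (G2_gamma F cug)) (in_var S (W_nu3 F cug))].
Proof.
have two_neq0 : 2%:R != 0 :> F by rewrite ((pcharf0P F).1 charF).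
have gN : (g, true) != (1%g, true) by rewrite xpair_eqE andbT.
have hN : (h, true) != (1%g, true) by rewrite xpair_eqE andbT.
(* A skew symbol differs from 1^+ even in degree 1, so [u] may be the identity. *)
have skewN (k : gT) : (k, false) != (1%g, true) by rewrite xpair_eqE andbF.
have mul3 := quadratic_growth_mul3 growth.
(* In each item [G2] is the case [w = -1] and [W] the case [w = 1], with the same two symbols. *)
by split=> c; apply: mult11_eq1 => //; apply: in_var_four.
Qed.
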